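(* Fix $t\in(0,1)$ and let $c(t)=\prod_{i=1}^\infty(1-t^i)\in(0,1)$. Suppose integers $a,b,z_1,z_2,t_1,t_2$ are given such that $t_1+1<t_2$, $0\le z_2-z_1\le t_2-t_1$, $0\le b-a\le t_2-t_1$, $z_1\le a$, $z_2\le b$. Fix any $\ell_{bot}\in\Omega(t_1,t_2;z_1,z_2)$, $S\subset\{t_1+1,\dots,t_2\}$ and $T\in\{t_1+1,\dots,t_2-1\}$. Let $m(T)$ and $M(T)$ denote the minimal and maximal values of the set $\{\ell(T):\ell\in\Omega(t_1,t_2;a,b)\}$ and let $k_1,k_2$ be integers with $m(T)\le k_1\le k_2\le M(T)$. Then $$c(t)\cdot\mathbb{E}^{t_1,t_2;a,b}_{free}\left[W_t(t_1,t_2,\ell,\ell_{bot};S)\mid\ell(T)=k_1\right]\le\mathbb{E}^{t_1,t_2;a,b}_{free}\left[W_t(t_1,t_2,\ell,\ell_{bot};S)\mid\ell(T)=k_2\right].$$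
   Context: An up-right path on $\{t_1,\dots,t_2\}$ is $\ell:\{t_1,\dots,t_2\}\to\mathbb{Z}$ with $\ell(i+1)-\ell(i)\in\{0,1\}$. $\Omega(t_1,t_2;z_1,z_2)$ is the set of up-right paths with $\ell(t_1)=z_1$, $\ell(t_2)=z_2$. $\mathbb{P}_{free}^{t_1,t_2;a,b}$ is the uniform distribution on $\Omega(t_1,t_2;a,b)$ and $\mathbb{E}_{free}^{t_1,t_2;a,b}$ the expectation over $\ell$ with this law. For paths $\ell,\ell_{bot}$ and $S\subset\{t_1+1,\dots,t_2\}$, with $\Delta(i)=\ell(i)-\ell_{bot}(i)$, $$W_t(t_1,t_2,\ell,\ell_{bot};S)=\prod_{i\in S}\left(1-\mathbf{1}_{\{\Delta(i-1)-\Delta(i)=1\}}t^{\Delta(i-1)}\right)$$ if $\ell(i)\ge\ell_{bot}(i)$ for all $i\in S$, and $W_t=0$ otherwise. *)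

(* Defs.v *)
From mathcomp Require Import all_boot all_order all_algebra finmap.
From mathcomp Require Import all_classical all_reals all_analysis.

Set Implicit Arguments.
Unset Strict Implicit.
Unset Printing Implicit Defensive.

Import Order.TTheory GRing.Theory Num.Theory.
Import numFieldNormedType.Exports.

Local Open Scope classical_set_scope.
Local Open Scope ring_scope.

(* A function {t1, ..., t2} -> Z is represented by its extension by 0 to all of
   int. This makes the representation unique, so counting elements of [Omega]
   counts paths. *)
Definition up_right (t1 t2 : int) (l : int -> int) : Prop :=
  (forall i, t1 <= i < t2 -> l (i + 1) - l i = 0 \/ l (i + 1) - l i = 1) /\
  (forall i, ~~ (t1 <= i <= t2) -> l i = 0).

Definition Omega (t1 t2 z1 z2 : int) : set (int -> int) :=
  [set l | [/\ up_right t1 t2 l, l t1 = z1 & l t2 = z2]].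

(* [fset_set] and [\sum_(_ \in _)] are only meaningful on finite sets; this
   lemma shows that they are used below within their domain. *)
Lemma finite_Omega (t1 t2 z1 z2 : int) : finite_set (Omega t1 t2 z1 z2).
Proof.
pose N := `|t2 - t1|%N.
pose dec (d : {ffun 'I_N -> bool}) (i : int) : int :=
  if t1 <= i <= t2 then z1 + \sum_(j < N | (j < `|i - t1|)%N) (d j)%:Z else 0.
apply: (@sub_finite_set _ _ (dec @` setT)); last first.
  by apply: finite_image; exact: finite_finset.
move=> l [[lstep lout] l1 l2].
pose d := [ffun j : 'I_N => l (t1 + j%:Z + 1) - l (t1 + j%:Z) == 1].
exists d => //; apply/funext => i; rewrite /dec.
case: ifPn => [/andP[t1i it2]|/lout //].
have HN : t2 - t1 = N%:Z by rewrite /N gez0_abs // subr_ge0 (le_trans t1i).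
have key n : (n <= N)%N ->
    l (t1 + n%:Z) = z1 + \sum_(j < N | (j < n)%N) (d j)%:Z.
  elim: n => [_|n IHn nN]; first by rewrite addr0 big_pred0_eq addr0.
  rewrite (bigD1 (Ordinal nN)) //= addrCA.
  rewrite (eq_bigl (fun j : 'I_N => (j < n)%N)); last first.
    by move=> j; rewrite -val_eqE /= ltnS ltn_neqAle andbC.
  rewrite -IHn ?(ltnW nN)// ffunE /= -addn1 PoszD addrA.
  have /lstep : t1 <= t1 + n%:Z < t2.
    by rewrite lerDl /= -ltrBrDl HN ltz_nat.
  case=> E; rewrite E; first by move/subr0_eq: E => ->; rewrite add0r.
  by move/eqP: E; rewrite subr_eq => /eqP ->.
have Hi : i - t1 = `|i - t1|%N by rewrite gez0_abs // subr_ge0.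
rewrite -key; first by rewrite -Hi addrC subrK.
by rewrite -lez_nat -Hi -HN lerD2r.
Qed.

Definition P_free (R : realType) (t1 t2 a b : int) (A : set (int -> int)) : R :=
  #|` fset_set (Omega t1 t2 a b `&` A)|%:R / #|` fset_set (Omega t1 t2 a b)|%:R.

Definition E_free (R : realType) (t1 t2 a b : int) (f : (int -> int) -> R) : R :=
  \sum_(l \in Omega t1 t2 a b) f l * P_free R t1 t2 a b [set l].

Definition E_free_cond (R : realType) (t1 t2 a b : int)
    (f : (int -> int) -> R) (A : set (int -> int)) : R :=
  E_free t1 t2 a b (fun l => f l * \1_A l) / P_free R t1 t2 a b A.

(* The exponent [D (i - 1)] is an integer: it may be negative, but the
   indicator only selects it when [D (i - 1) = D i + 1 >= 1]. *)
Definition W (R : realType) (t : R) (l lbot : int -> int) (S : {fset int}) : R :=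
  let D i := l i - lbot i in
  if all (fun i => lbot i <= l i) S then
    \prod_(i <- S) (1 - (D (i - 1) - D i == 1)%:R * t ^ D (i - 1))
  else 0.

Definition cprod (R : realType) (t : R) : R :=
  limn (fun n => \prod_(1 <= i < n.+1) (1 - t ^+ i)).

Definition is_min (A : set int) (m : int) : Prop := A m /\ lbound A m.
Definition is_max (A : set int) (m : int) : Prop := A m /\ ubound A m.

(* Main.v *)
Require Import Defs.
From mathcomp Require Import all_boot all_order all_algebra finmap.
From mathcomp Require Import all_classical all_reals all_analysis.
From mathcomp Require Import ring zify.

(* Couple the two conditioned path laws monotonically: before time [T] the set
   of up-steps of the lower path is contained in that of the upper path, and
   after [T] the same holds for the flat steps. Then the gap between the paths grows
   to [k2 - k1] up to time [T] and afterwards shrinks back to 0, taking each of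
   the values [k2 - k1, ..., 1] exactly once just before a decrease. The factors
   of the upper weight without counterpart in the lower one occur at such
   decreases, so their product is at least the Euler product. Nested
   sets of fixed sizes form a biregular bipartite graph, so the pointwise
   comparison passes to averages by double counting. *)

Set Implicit Arguments.
Unset Strict Implicit.
Unset Printing Implicit Defensive.

Import Order.TTheory GRing.Theory Num.Theory.
Import numFieldNormedType.Exports.

Local Open Scope classical_set_scope.
Local Open Scope ring_scope.

(** * Partial Euler products and their limit *)

Section EulerProduct.
Variables (R : realType) (t : R).
Hypothesis t01 : 0 < t < 1.

Definition euler_prod (n : nat) : R := \prod_(1 <= i < n.+1) (1 - t ^+ i).

Let t_gt0 : 0 < t. Proof. by case/andP: t01. Qed.
Let t_lt1 : t < 1. Proof. by case/andP: t01. Qed.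

Lemma euler_prodS n : euler_prod n.+1 = euler_prod n * (1 - t ^+ n.+1).
Proof. by rewrite /euler_prod big_nat_recr. Qed.

Lemma euler_factor_gt0 n : 0 < 1 - t ^+ n.+1.
Proof. by rewrite subr_gt0 exprn_ilt1 // ltW. Qed.

Lemma euler_prod_gt0 n : 0 < euler_prod n.
Proof.
elim: n => [|n IHn]; first by rewrite /euler_prod big_geq.
by rewrite euler_prodS mulr_gt0 // euler_factor_gt0.
Qed.

Lemma euler_prod_nonincreasing : nonincreasing_seq euler_prod.
Proof.
apply/nonincreasing_seqP => n; rewrite euler_prodS ler_piMr ?ltW ?euler_prod_gt0//.
by rewrite gtrBl exprn_gt0.
Qed.

(* [1 - x >= exp (- x / (1 - x))], then a geometric sum in the exponent. *)
Lemma euler_prod_ge n :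
  expR (- (t * (1 - t ^+ n) / (1 - t) ^+ 2)) <= euler_prod n.
Proof.
have t1 : 0 < 1 - t by rewrite subr_gt0.
elim: n => [|n IHn].
  by rewrite expr0 subrr mulr0 mul0r oppr0 expR0 /euler_prod big_geq.
set x := t ^+ n.+1.
have x1 : 0 < 1 - x by exact: euler_factor_gt0.
have x0 : 0 < x by exact: exprn_gt0.
have xt : x <= t.
  by rewrite /x exprS ler_piMr ?exprn_ile1 ?(ltW t_gt0) ?(ltW t_lt1).
have -> : - (t * (1 - x) / (1 - t) ^+ 2) =
    - (t * (1 - t ^+ n) / (1 - t) ^+ 2) - x / (1 - t).
  by rewrite /x exprS; field; rewrite gt_eqF.
rewrite expRD euler_prodS ler_pM ?expR_ge0 //.
rewrite expRN -[leRHS]invrK lef_pV2 ?posrE ?expR_gt0 ?invr_gt0 //.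
apply: le_trans (expR_ge1Dx _).
have -> : (1 - x)^-1 = 1 + x / (1 - x) by field; rewrite gt_eqF.
by rewrite lerD2l ler_pM2l // lef_pV2 ?posrE // lerD2l lerN2.
Qed.

Lemma is_cvg_euler_prod : cvgn euler_prod.
Proof.
apply: nonincreasing_is_cvgn; first exact: euler_prod_nonincreasing.
by exists 0 => _ [n _ <-]; exact/ltW/euler_prod_gt0.
Qed.

Lemma cprod_le_euler_prod n : cprod t <= euler_prod n.
Proof.
exact: (nonincreasing_cvgn_ge euler_prod_nonincreasing is_cvg_euler_prod).
Qed.

(** Bounding [1 - t ^+ n] by 1 in [euler_prod_ge] gives a positive lower bound free of [n], which
    survives the limit. *)
Lemma cprod_gt0 : 0 < cprod t.
Proof.
apply: (@lt_le_trans _ _ (expR (- (t / (1 - t) ^+ 2)))); first exact: expR_gt0.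
apply: limr_ge; first exact: is_cvg_euler_prod.
near=> n; apply: le_trans (euler_prod_ge n).
rewrite ler_expR lerN2 ler_pM2r ?invr_gt0 ?exprn_gt0 ?subr_gt0 //.
by rewrite ler_piMr ?ltW // gtrBl exprn_gt0.
Unshelve. all: end_near. Qed.

Lemma cprod_lt1 : cprod t < 1.
Proof.
apply: le_lt_trans (cprod_le_euler_prod 1) _.
by rewrite /euler_prod big_nat1 gtrBl expr1.
Qed.

End EulerProduct.

(** * Double counting in biregular graphs of nested sets *)

(** Sum [f x <= g y] over all edges: each [f x] occurs [d1] times and each [g y] occurs [d2] times.
    Both averages have the number of edges as common denominator, since [d1 * #|P|] and [d2 * #|Q|]
    both count them. *)
Lemma ler_regular_average (R : realFieldType) (X Y : finType)
    (P : {set X}) (Q : {set Y}) (r : X -> Y -> bool) (d1 d2 : nat)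
    (f : X -> R) (g : Y -> R) :
  (0 < d1)%N -> (0 < d2)%N ->
  (forall x, x \in P -> #|[set y in Q | r x y]| = d1) ->
  (forall y, y \in Q -> #|[set x in P | r x y]| = d2) ->
  (forall x y, x \in P -> y \in Q -> r x y -> f x <= g y) ->
  (\sum_(x in P) f x) / #|P|%:R <= (\sum_(y in Q) g y) / #|Q|%:R.
Proof.
move=> d1_gt0 d2_gt0 degP degQ fg.
have sumP (h : X -> R) :
    \sum_(x in P) h x *+ d1 = \sum_(x in P) \sum_(y in Q | r x y) h x.
  apply: eq_bigr => x /degP <-; rewrite -sumr_const.
  by apply: eq_bigl => y; rewrite inE.
have sumQ (h : Y -> R) :
    \sum_(y in Q) h y *+ d2 = \sum_(x in P) \sum_(y in Q | r x y) h y.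
  rewrite (exchange_big_dep (mem Q)) /=; last by move=> ? ? _ /andP[].
  apply: eq_bigr => y yQ; rewrite -(degQ y yQ) -sumr_const.
  by apply: eq_bigl => x; rewrite inE yQ.
have edges : (d1 * #|P|)%:R = (d2 * #|Q|)%:R :> R.
  rewrite ![(_ * #|_|)%N]mulnC !natrM !mulr_natr -!sumr_const -!sumrMnl.
  by rewrite sumP sumQ.
have scale (d n : nat) (u : R) : (0 < d)%N -> u / n%:R = d%:R * u / (d * n)%:R.
  by move=> d_gt0; rewrite natrM -mulf_div divff ?mul1r // pnatr_eq0 -lt0n.
rewrite (scale d1) // (scale d2 #|Q|) // edges ler_wpM2r ?invr_ge0 ?ler0n //.
rewrite !mulr_natl -!sumrMnl sumP sumQ.
by apply: ler_sum => x xP; apply: ler_sum => y /andP[yQ]; exact: fg.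
Qed.

(** Complementation turns these sets into the subsets of [~: A] of size [#|T| - n]; the bound on [n]
    keeps this subtraction from being truncated. *)
Lemma card_supersets (T : finType) (A : {set T}) (n : nat) :
  (n <= #|T|)%N ->
  #|[set B : {set T} | A \subset B & #|B| == n]| = 'C(#|T| - #|A|, #|T| - n).
Proof.
move=> nT; have <- : #|~: A| = (#|T| - #|A|)%N by rewrite cardsCs finset.setCK.
rewrite -cards_draws -[LHS](card_imset _ (@finset.setC_inj T)).
rewrite (can2_imset_pre _ (@finset.setCK T) (@finset.setCK T)).
apply: eq_card => B.
rewrite !inE -finset.setCS finset.setCK [in LHS]cardsCs finset.setCK; congr (_ && _).
have BT : (#|B| <= #|T|)%N by exact: max_card. apply/eqP/eqP; lia.
Qed.

(** * Factors of the weight as functions of a gap *)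

Lemma ler_prod_uniq_sub (R : realDomainType) (I : eqType) (s r : seq I)
    (g : I -> R) :
  uniq s -> uniq r -> {subset s <= r} -> {in r, forall i, 0 <= g i <= 1} ->
  \prod_(i <- r) g i <= \prod_(i <- s) g i.
Proof.
move=> us ur sr g01.
have /(perm_big _) -> : perm_eq s [seq i <- r | i \in s].
  apply: uniq_perm => //; first exact: filter_uniq.
  by move=> i; rewrite mem_filter andb_idr //; exact: sr.
rewrite big_filter [leRHS]big_mkcond /= big_seq [leRHS]big_seq.
apply: ler_prod => i /g01 /andP[g0 g1]; rewrite g0 /=.
by case: ifP.
Qed.

(** The factor of [W], for an arbitrary gap [D]: it serves both for the gap of a path to [lbot] and
    for the gap between two coupled paths. *)
Definition gap_factor (R : realType) (t : R) (D : int -> int) (i : int) : R :=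
  1 - (D (i - 1) - D i == 1)%:R * t ^ D (i - 1).

Lemma unimodal_ge0 (e : nat -> int) (p q : nat) :
  0 <= e 0%N -> 0 <= e (p + q)%N ->
  (forall n, (n < p)%N -> e n <= e n.+1) ->
  (forall n, (p <= n < p + q)%N -> e n.+1 <= e n) ->
  forall n, (n <= p + q)%N -> 0 <= e n.
Proof.
move=> e0 eN up down n; have [np _|pn nN] := leqP n p.
  elim: n np => // n IHn np; exact: le_trans (IHn (ltnW np)) (up n np).
(* On the falling part, induct backwards from the end, where the value is nonnegative. *)
rewrite -(subKn nN); have : (p + q - n <= q)%N by lia.
elim: (p + q - n)%N => [|m IHm mq]; first by rewrite subn0.
apply: le_trans (IHm (ltnW mq)) _.
have -> : (p + q - m = (p + q - m.+1).+1)%N by lia.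
by apply: down; lia.
Qed.

Section GapFactor.
Variables (R : realType) (t : R).
Hypothesis t01 : 0 < t < 1.

Let t_gt0 : 0 < t. Proof. by case/andP: t01. Qed.
Let t_lt1 : t < 1. Proof. by case/andP: t01. Qed.

Lemma gap_factor_ge0 (D : int -> int) i : 0 <= D i -> 0 <= gap_factor t D i.
Proof.
rewrite /gap_factor => Di; case: eqP => [E|_]; last by rewrite mul0r subr0.
have : 0 <= D (i - 1) by lia.
case: (D (i - 1)) => // n _.
by rewrite mul1r subr_ge0 exprn_ile1 // ltW.
Qed.

Lemma gap_factor_le1 (D : int -> int) i : gap_factor t D i <= 1.
Proof. by rewrite gerBl mulr_ge0 ?ler0n // exprz_ge0 // ltW. Qed.

Lemma W_ge0 (l lbot : int -> int) (S : {fset int}) : 0 <= W t l lbot S.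
Proof.
rewrite /W; case: ifP => // /allP lS.
rewrite big_seq; apply: prodr_ge0 => i /lS li.
by apply: (@gap_factor_ge0 (fun i => l i - lbot i)); rewrite subr_ge0.
Qed.

(* A factor of the higher path is either dominated by the same factor of the
   lower one, or comes from a step at which the two paths get closer. *)
Lemma gap_factor_mul_le (D1 D2 : int -> int) i (u1 u2 v : bool) :
  D1 i = D1 (i - 1) + u1%:Z - v%:Z -> D2 i = D2 (i - 1) + u2%:Z - v%:Z ->
  0 <= D1 i -> D1 (i - 1) <= D2 (i - 1) -> D1 i <= D2 i ->
  gap_factor t (fun j => D2 j - D1 j) i * gap_factor t D1 i <= gap_factor t D2 i.
Proof.
move=> E1 E2 D1i le12p le12.
have g0 : 0 <= gap_factor t (fun j => D2 j - D1 j) i.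
  by apply: gap_factor_ge0; rewrite subr_ge0.
have mono (m n : int) : 0 <= m -> m <= n -> t ^ n <= t ^ m.
  move=> m0 mn; apply: (ler_wpiXz2l (ltW t_gt0) (ltW t_lt1)) => //.
  exact: le_trans mn.
rewrite {3}/gap_factor; case: eqP => [F|_]; last first.
  rewrite mul0r subr0.
  apply: le_trans (ler_wpM2l g0 (gap_factor_le1 _ _)) _.
  by rewrite mulr1 gap_factor_le1.
have [v1 u20] : v = true /\ u2 = false by case: (v) (u2) E2 => [] []; lia.
(* If the lower path steps up, the coupled gap drops from [D2 (i - 1) - D1 (i - 1)], which is at
   most [D2 (i - 1)]. Otherwise [D1] itself drops, from a value at most [D2 (i - 1)]. Either way a
   smaller exponent gives a smaller factor. *)
case: u1 E1 => E1.
  have -> : gap_factor t D1 i = 1.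
    by rewrite /gap_factor; case: eqP => [?|_]; [lia|rewrite mul0r subr0].
  rewrite mulr1 /gap_factor; case: eqP => [_|]; last by lia.
  by rewrite !mul1r lerD2l lerN2 mono //; lia.
have -> : gap_factor t (fun j => D2 j - D1 j) i = 1.
  by rewrite /gap_factor; case: eqP => [?|_]; [lia|rewrite mul0r subr0].
rewrite mul1r /gap_factor; case: eqP => [_|]; last by lia.
by rewrite !mul1r lerD2l lerN2 mono //; lia.
Qed.

(** While [D] rises all factors are 1. While it falls by steps of 0 or 1 down to 0, each drop from
    [m + 1] to [m] contributes [1 - t ^+ m.+1], and every level below the peak is crossed once. *)
Lemma prod_gap_factor_unimodal (D : int -> int) (t1 : int) (p q : nat) :
  (forall n, (n < p)%N -> D (t1 + n%:Z) <= D (t1 + n.+1%:Z)) ->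
  (forall n, (n < q)%N ->
     exists c : bool, D (t1 + (p + n)%:Z) = D (t1 + (p + n).+1%:Z) + c%:Z) ->
  (forall n, (n <= q)%N -> 0 <= D (t1 + (p + n)%:Z)) ->
  D (t1 + (p + q)%:Z) = 0 ->
  \prod_(0 <= n < p + q) gap_factor t D (t1 + n.+1%:Z)
    = euler_prod t (absz (D (t1 + p%:Z))).
Proof.
move=> up down nonneg Dend.
have pred n : t1 + n.+1%:Z - 1 = t1 + n%:Z by lia.
rewrite (@big_cat_nat _ _ _ p) ?leq_addr //= big1_seq ?mul1r; last first.
  move=> n /andP[_]; rewrite mem_index_iota => /= np.
  rewrite /gap_factor pred; case: eqP => [E|_]; last by rewrite mul0r subr0.
  by have := up n np; lia.
(* Invariant of the descent: the factors met so far times the Euler product of the current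
   height. *)
suff key n : (n <= q)%N ->
    euler_prod t (absz (D (t1 + p%:Z))) =
    (\prod_(p <= j < p + n) gap_factor t D (t1 + j.+1%:Z)) *
      euler_prod t (absz (D (t1 + (p + n)%:Z))).
  by rewrite (key q) // Dend /euler_prod [X in _ * X]big_geq ?mulr1.
elim: n => [_|n IHn nq]; first by rewrite addn0 big_geq // mul1r.
rewrite IHn ?(ltnW nq) // addnS big_nat_recr ?leq_addr //= -mulrA; congr (_ * _).
have := nonneg n.+1 nq; rewrite addnS.
rewrite /gap_factor pred; have [c ->] := down n nq.
move: (D _) => [m|//] _; rewrite [_ + c%:Z]addrC addrK; case: c => /=; last first.
  by rewrite add0r mul0r subr0 mul1r.
by rewrite mul1r mulrC -PoszD add1n euler_prodS.
Qed.

End GapFactor.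

(** * Pointwise comparison of the weights of two coupled paths *)

Definition is_step (l : int -> int) (i : int) : Prop :=
  exists c : bool, l (i + 1) = l i + c%:Z.

(** Factor by factor, the weight of [l2] dominates that of [l1] times the gap factors of [l2 - l1]
    over [S]. Those are at least the product over all times, a partial Euler product, hence at least
    [cprod t]. *)
Lemma W_le_unimodal (R : realType) (t : R) (l1 l2 lbot : int -> int)
    (S : {fset int}) (t1 : int) (p q : nat) :
  0 < t < 1 ->
  (forall i, i \in S -> t1 + 1 <= i <= t1 + (p + q)%:Z) ->
  (forall i, t1 <= i < t1 + (p + q)%:Z -> is_step l1 i) ->
  (forall i, t1 <= i < t1 + (p + q)%:Z -> is_step l2 i) ->
  (forall i, t1 <= i < t1 + (p + q)%:Z -> is_step lbot i) ->
  l1 t1 = l2 t1 -> l1 (t1 + (p + q)%:Z) = l2 (t1 + (p + q)%:Z) ->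
  (forall i, t1 <= i < t1 + p%:Z -> l2 i - l1 i <= l2 (i + 1) - l1 (i + 1)) ->
  (forall i, t1 + p%:Z <= i < t1 + (p + q)%:Z ->
     l2 (i + 1) - l1 (i + 1) <= l2 i - l1 i) ->
  cprod t * W t l1 lbot S <= W t l2 lbot S.
Proof.
move=> t01 Sr step1 step2 step3 Dt1 Dt2 up down; set D := fun i => l2 i - l1 i.
have [/allP l1S|] := boolP (all (fun i => lbot i <= l1 i) S); last first.
  by move=> /negbTE l1S; rewrite {1}/W l1S mulr0 W_ge0.
have pred n : t1 + n%:Z + 1 = t1 + n.+1%:Z by lia.
have D_ge0 n : (n <= p + q)%N -> 0 <= D (t1 + n%:Z).
  apply: (@unimodal_ge0 (fun n => D (t1 + n%:Z)) p q) => /= [|||{}n].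
  - by rewrite addr0 /D Dt1 subrr.
  - by rewrite /D Dt2 subrr.
  - by move=> m mp; rewrite -(pred m); apply: up; lia.
  - by move=> npq; rewrite -pred; apply: down; lia.
have D_ge0' i : t1 <= i <= t1 + (p + q)%:Z -> 0 <= D i.
  by move=> /andP[t1i it2]; have := @D_ge0 (absz ((i - t1) : int));
    (have -> : t1 + (absz ((i - t1) : int))%:Z = i by lia); apply; lia.
have Sprev i : i \in S -> t1 <= i - 1 < t1 + (p + q)%:Z by move=> /Sr; lia.
have l2S : all (fun i => lbot i <= l2 i) S.
  apply/allP => i iS; apply: le_trans (l1S i iS) _.
  by rewrite -subr_ge0 D_ge0' //; have := Sr i iS; lia.
have gap01 n : (n < p + q)%N -> 0 <= gap_factor t D (t1 + n.+1%:Z) <= 1.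
  by move=> nq; rewrite gap_factor_le1 // gap_factor_ge0 // D_ge0.
apply: (@le_trans _ _ (\prod_(i <- S) gap_factor t D i * W t l1 lbot S)).
  apply: ler_wpM2r; first exact: W_ge0.
  apply: (@le_trans _ _ (\prod_(0 <= n < p + q) gap_factor t D (t1 + n.+1%:Z))).
    rewrite (@prod_gap_factor_unimodal _ _ _ D t1 p q) ?cprod_le_euler_prod //.
    - move=> n np; have -> : t1 + n.+1%:Z = t1 + n%:Z + 1 by lia.
      by apply: up; lia.
    - move=> n nq; have -> : t1 + (p + n).+1%:Z = t1 + (p + n)%:Z + 1 by lia.
      set i := t1 + (p + n)%:Z.
      have it : t1 + p%:Z <= i < t1 + (p + q)%:Z by rewrite /i; lia.
      have it' : t1 <= i < t1 + (p + q)%:Z by lia.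
      have [c1 E1] := step1 i it'.
      have [c2 E2] := step2 i it'.
      have := down i it; rewrite /D E1 E2 => le21.
      (* The gap drops exactly when [l1] rises and [l2] stays flat; [le21] excludes the opposite
         case. *)
      by exists (c1 && ~~ c2); move: le21; case: (c1); case: (c2) => /=; lia.
    - by move=> n nq; apply: D_ge0; rewrite leq_add2l.
    - by rewrite /D Dt2 subrr.
  rewrite -(big_map (fun n => t1 + n.+1%:Z) predT (gap_factor t D)).
  apply: ler_prod_uniq_sub.
  - exact: fset_uniq.
  - by rewrite map_inj_uniq ?iota_uniq // => m n /addrI [].
  - move=> i /Sr ti; apply/mapP; exists (absz ((i - t1 - 1) : int)); last by lia.
    by rewrite mem_index_iota; lia.
  - by move=> _ /mapP[n + ->]; rewrite mem_index_iota => /=; exact: gap01.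
rewrite /W l2S (introT allP l1S) -big_split /= big_seq [leRHS]big_seq.
apply: ler_prod => i iS.
have [c1 E1] := step1 _ (Sprev i iS).
have [c2 E2] := step2 _ (Sprev i iS).
have [c3 E3] := step3 _ (Sprev i iS).
rewrite !subrK in E1 E2 E3.
have ti := Sr i iS; have Di : 0 <= D i by apply: D_ge0'; lia.
have Dp : 0 <= D (i - 1) by apply: D_ge0'; lia.
have l1i := l1S i iS.
apply/andP; split.
  rewrite mulr_ge0 ?gap_factor_ge0 //.
  by apply: (@gap_factor_ge0 _ _ _ (fun j => l1 j - lbot j)); rewrite ?subr_ge0.
have -> : gap_factor t D i =
    gap_factor t (fun j => (l2 j - lbot j) - (l1 j - lbot j)) i.
  by congr gap_factor; apply/funext => j; rewrite /D; lia.
apply: (@gap_factor_mul_le _ _ t01 (fun j => l1 j - lbot j)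
  (fun j => l2 j - lbot j) i c1 c2 c3) => /=; rewrite /D in Di Dp; lia.
Qed.

(** * Paths built from their sequences of steps *)

Definition path_of_steps (t1 a : int) (N : nat) (s : nat -> bool) (i : int) : int :=
  if t1 <= i <= t1 + N%:Z then a + (\sum_(0 <= j < absz (i - t1)) s j)%N%:Z else 0.

Lemma path_of_stepsE t1 a N (s : nat -> bool) n : (n <= N)%N ->
  path_of_steps t1 a N s (t1 + n%:Z) = a + (\sum_(0 <= j < n) s j)%N%:Z.
Proof.
move=> nN; rewrite /path_of_steps ifT; last by lia.
by rewrite [t1 + _]addrC addrK.
Qed.

Lemma path_of_stepsS t1 a N (s : nat -> bool) n : (n < N)%N ->
  path_of_steps t1 a N s (t1 + n.+1%:Z) =
  path_of_steps t1 a N s (t1 + n%:Z) + (s n)%:Z.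
Proof.
move=> nN; rewrite !path_of_stepsE ?(ltnW nN) //.
by rewrite big_nat_recr //= PoszD addrA.
Qed.

Lemma path_of_steps_step t1 a N (s : nat -> bool) i : t1 <= i < t1 + N%:Z ->
  path_of_steps t1 a N s (i + 1) =
  path_of_steps t1 a N s i + (s (absz (i - t1)))%:Z.
Proof.
move=> it; have Ei : i = t1 + (absz (i - t1))%:Z by lia.
have -> : i + 1 = t1 + (absz (i - t1)).+1%:Z by lia.
by rewrite path_of_stepsS; [rewrite -Ei|lia].
Qed.

Lemma path_of_steps_Omega t1 a N (s : nat -> bool) :
  Omega t1 (t1 + N%:Z) a (a + (\sum_(0 <= j < N) s j)%N%:Z) (path_of_steps t1 a N s).
Proof.
split; last 1 first.
- exact: path_of_stepsE.
- split=> [i it|i /negbTE it]; last by rewrite /path_of_steps it.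
  rewrite path_of_steps_step // [_ + (s _)%:Z]addrC addrK.
  by case: (s _); [right|left].
- by have := @path_of_stepsE t1 a N s 0 isT; rewrite addr0 big_geq // addr0.
Qed.

(** Any [s] that agrees with the steps of [l] below [N] is allowed, so that both the raw step
    function and [split_steps] fit. *)
Lemma Omega_steps t1 N a b l : Omega t1 (t1 + N%:Z) a b l ->
  forall s : nat -> bool,
  (forall n, (n < N)%N -> s n = (l (t1 + n.+1%:Z) == l (t1 + n%:Z) + 1)) ->
  l = path_of_steps t1 a N s.
Proof.
move=> [[lstep lout] l1 l2] s sE; apply/funext => i.
have [it|it] := boolP (t1 <= i <= t1 + N%:Z); last first.
  by rewrite lout // /path_of_steps (negbTE it).
have -> : i = t1 + (absz (i - t1))%:Z by lia.
have : (absz (i - t1) <= N)%N by lia.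
elim: (absz _) => [|n IHn nN].
  by rewrite path_of_stepsE // addr0 big_geq // addr0.
rewrite path_of_stepsS // -IHn ?(ltnW nN) // sE //.
have /lstep : t1 <= t1 + n%:Z < t1 + N%:Z by lia.
have -> : t1 + n%:Z + 1 = t1 + n.+1%:Z by lia.
by move=> [] /eqP; rewrite subr_eq ?add0r => /eqP ->; case: eqP; lia.
Qed.

(** * Paths with a prescribed middle height as pairs of sets *)

Section SplitSteps.
Variables p q : nat.
Implicit Type x : {set 'I_p} * {set 'I_q}.

(* The first set collects the up-steps before time [p], the second one the flat
   steps after time [p]; enlarging either set raises the path at time [p]
   relatively to its endpoints. *)
Definition split_steps x (n : nat) : bool :=
  if (n < p)%N then [exists j in x.1, val j == n]
  else ~~ [exists j in x.2, (p + val j)%N == n].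

Lemma split_steps_left x (j : 'I_p) : split_steps x j = (j \in x.1).
Proof.
rewrite /split_steps ltn_ord.
apply/existsP/idP => [[k /andP[kx /eqP/val_inj <-]]//|jx].
by exists j; rewrite jx /=.
Qed.

Lemma split_steps_right x (j : 'I_q) : split_steps x (p + j) = (j \notin x.2).
Proof.
rewrite /split_steps ltnNge leq_addr /=; congr (~~ _).
apply/existsP/idP => [[k /andP[kx]]|jx].
  by rewrite eqn_add2l => /eqP/val_inj <-.
by exists j; rewrite jx /=.
Qed.

Lemma sum_split_steps_left x : (\sum_(0 <= j < p) split_steps x j)%N = #|x.1|.
Proof.
rewrite big_mkord -sum1_card [RHS]big_mkcond /=.
by apply: eq_bigr => j _; rewrite split_steps_left; case: (_ \in _).
Qed.

Lemma sum_split_steps x :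
  (\sum_(0 <= j < p + q) split_steps x j)%N = (#|x.1| + (q - #|x.2|))%N.
Proof.
rewrite (@big_cat_nat _ _ _ p) ?leq_addr //= sum_split_steps_left; congr addn.
rewrite -[p in LHS]add0n big_addn addKn big_mkord.
have <- : #|~: x.2| = (q - #|x.2|)%N by rewrite cardsCs finset.setCK card_ord.
rewrite -sum1_card [RHS]big_mkcond /=.
by apply: eq_bigr => j _; rewrite addnC split_steps_right inE; case: (_ \in _).
Qed.

Definition subset_pairs (m1 m2 : nat) : {set {set 'I_p} * {set 'I_q}} :=
  finset.setX [set A : {set 'I_p} | #|A| == m1]%SET
    [set B : {set 'I_q} | #|B| == m2]%SET.

Lemma in_subset_pairs m1 m2 x :
  (x \in subset_pairs m1 m2) = (#|x.1| == m1) && (#|x.2| == m2).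
Proof. by rewrite !inE. Qed.

Definition split_path (t1 a : int) x : int -> int :=
  path_of_steps t1 a (p + q) (split_steps x).

Lemma split_path_bij t1 a m1 m2 : (m2 <= q)%N ->
  set_bij [set` subset_pairs m1 m2]
    (Omega t1 (t1 + (p + q)%:Z) a (a + (m1 + (q - m2))%:Z) `&`
       [set l | l (t1 + p%:Z) = a + m1%:Z])
    (split_path t1 a).
Proof.
move=> m2q; split.
- move=> x /=; rewrite in_subset_pairs => /andP[/eqP <- /eqP <-]; split.
    by rewrite -sum_split_steps; exact: path_of_steps_Omega.
  by rewrite /= /split_path path_of_stepsE ?leq_addr // sum_split_steps_left.
- move=> x y _ _ xy.
  have key n : (n < p + q)%N -> split_steps x n = split_steps y n.
    move=> npq; have := @path_of_stepsS t1 a _ (split_steps x) _ npq.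
    rewrite -/(split_path t1 a x) xy /split_path path_of_stepsS // => /addrI.
    by case: split_steps; case: split_steps.
  rewrite [x]surjective_pairing [y]surjective_pairing; congr pair.
    apply/setP => j; rewrite -!split_steps_left key //.
    by rewrite (leq_trans (ltn_ord j)) // leq_addr.
  apply/setP => j; apply: negb_inj; rewrite -!split_steps_right key //.
  by rewrite ltn_add2l.
- move=> l [lO /= lp].
  (* Surjectivity: read the two sets off the increments of [l]. *)
  pose st n := l (t1 + n.+1%:Z) == l (t1 + n%:Z) + 1.
  pose x := ([set j : 'I_p | st j]%SET, [set j : 'I_q | ~~ st (p + j)%N]%SET).
  have lE : l = split_path t1 a x.
    apply: (Omega_steps lO) => n npq; have [np|pn] := ltnP n p.
      by rewrite (split_steps_left x (Ordinal np)) inE.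
    have nq : (n - p < q)%N by lia.
    have -> : n = (p + Ordinal nq)%N by rewrite /= subnKC.
    by rewrite split_steps_right inE negbK.
  exists x => //=; rewrite in_subset_pairs.
  have x1 : #|x.1| = m1.
    move: lp; rewrite lE /split_path path_of_stepsE ?leq_addr // sum_split_steps_left.
    by move=> /addrI [].
  have x2 : (#|x.2| <= q)%N by rewrite -[leqRHS]card_ord max_card.
  case: lO => _ _; rewrite lE /split_path path_of_stepsE // sum_split_steps x1 eqxx.
  move=> /addrI [] /eqP; rewrite eqn_add2l => /eqP E.
  (* The endpoint only fixes [q - #|x.2|]; both [#|x.2|] and [m2] are at most [q], so the truncated
     subtraction can be inverted. *)
  by rewrite -(subKn x2) E subKn // eqxx.
Qed.

(** One of the two degrees of the nesting graph; the components are chosen independently, hence a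
    product of binomials. The next lemma gives the other degree. *)
Lemma card_subset_pairs_ge m1 m2 n1 n2 x :
  (n1 <= p)%N -> (n2 <= q)%N -> x \in subset_pairs m1 m2 ->
  #|[set y in subset_pairs n1 n2 | (x.1 \subset y.1) && (x.2 \subset y.2)]|
    = ('C(p - m1, p - n1) * 'C(q - m2, q - n2))%N.
Proof.
move=> n1p n2q; rewrite in_subset_pairs => /andP[/eqP x1 /eqP x2].
have := @card_supersets _ x.1 n1; have := @card_supersets _ x.2 n2.
rewrite !card_ord x1 x2 => /(_ n2q) <- /(_ n1p) <-; rewrite -cardsX.
by apply: eq_card => y; rewrite !inE andbACA ![(#|_| == _) && _]andbC.
Qed.

Lemma card_subset_pairs_le m1 m2 n1 n2 y :
  y \in subset_pairs n1 n2 ->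
  #|[set x in subset_pairs m1 m2 | (x.1 \subset y.1) && (x.2 \subset y.2)]|
    = ('C(n1, m1) * 'C(n2, m2))%N.
Proof.
rewrite in_subset_pairs => /andP[/eqP <- /eqP <-].
rewrite -!cards_draws -cardsX.
by apply: eq_card => x; rewrite !inE andbACA ![(#|_| == _) && _]andbC.
Qed.

(** Before [p], whenever the path of [x] rises so does that of [y]; after [p], whenever the path of
    [x] is flat so is that of [y]. *)
Lemma split_path_gap (t1 a : int) (x y : {set 'I_p} * {set 'I_q}) :
  x.1 \subset y.1 -> x.2 \subset y.2 ->
  let D i := split_path t1 a y i - split_path t1 a x i in
  (forall i, t1 <= i < t1 + p%:Z -> D i <= D (i + 1)) /\
  (forall i, t1 + p%:Z <= i < t1 + (p + q)%:Z -> D (i + 1) <= D i).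
Proof.
move=> /fintype.subsetP xy1 /fintype.subsetP xy2 D; split => i it; rewrite /D.
  rewrite /split_path !path_of_steps_step; [|lia..].
  have ip : (absz ((i - t1) : int) < p)%N by lia.
  rewrite -[absz _]/(nat_of_ord (Ordinal ip)) !split_steps_left.
  by have := xy1 (Ordinal ip); case: (_ \in x.1); case: (_ \in y.1); lia.
rewrite /split_path !path_of_steps_step; [|lia..].
have iq : (absz ((i - t1) : int) - p < q)%N by lia.
have -> : absz ((i - t1) : int) = (p + Ordinal iq)%N by rewrite /=; lia.
rewrite !split_steps_right.
by have := xy2 (Ordinal iq); case: (_ \in x.2); case: (_ \in y.2) => /=; lia.
Qed.

End SplitSteps.

(** * Conditional expectations as averages over pairs of sets *)

Lemma E_free_condE (R : realType) (t1 t2 a b : int) (f : (int -> int) -> R)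
    (A : set (int -> int)) :
  E_free_cond t1 t2 a b f A =
    (\sum_(l \in Omega t1 t2 a b `&` A) f l) /
    (\sum_(l \in Omega t1 t2 a b `&` A) (1 : R)).
Proof.
have finO := finite_Omega t1 t2 a b.
have finOA : finite_set (Omega t1 t2 a b `&` A) by exact: finite_setIl.
rewrite /E_free_cond /E_free /P_free.
set N : R := #|` _|%:R.
have -> : \sum_(l \in Omega t1 t2 a b) f l * \1_A l *
      (#|` fset_set (Omega t1 t2 a b `&` [set l])|%:R / N) =
    (\sum_(l \in Omega t1 t2 a b `&` A) f l) / N.
  rewrite fsbig_mkcondr !fsbig_finite // mulr_suml big_seq [RHS]big_seq.
  apply: eq_bigr => l; rewrite in_fset_set // inE => lO.
  have -> : Omega t1 t2 a b `&` [set l] = [set l].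
    by apply/setIidPr => _ ->.
  rewrite fset_set1 cardfs1 div1r indicE.
  by case: (l \in A); rewrite ?mulr1 ?mulr0.
have -> : \sum_(l \in Omega t1 t2 a b `&` A) (1 : R) =
    #|` fset_set (Omega t1 t2 a b `&` A)|%:R.
  by rewrite (fsbig_finite _ (fun=> 1)) // card_fset_sum1 natr_sum.
(* The normaliser [N] cancels unless there is no path at all, and then both sides are 0. *)
have [N0|N0] := eqVneq N 0; last by rewrite invfM invrK mulrACA mulVf ?mulr1.
move: N0 => /eqP; rewrite /N pnatr_eq0 cardfs_eq0 => /eqP O0.
have -> : Omega t1 t2 a b = set0 by apply: fset_set_set0.
by rewrite set0I fsbig_set0 !mul0r.
Qed.

Lemma E_free_cond_split_path (R : realType) (p q : nat) (t1 a : int) (m1 m2 : nat)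
    (f : (int -> int) -> R) : (m2 <= q)%N ->
  E_free_cond t1 (t1 + (p + q)%:Z) a (a + (m1 + (q - m2))%:Z) f
    [set l | l (t1 + p%:Z) = a + m1%:Z] =
  (\sum_(x in subset_pairs p q m1 m2) f (split_path t1 a x)) /
    #|subset_pairs p q m1 m2|%:R.
Proof.
move=> m2q; rewrite E_free_condE.
have reindex (g : (int -> int) -> R) :
    \sum_(l \in Omega t1 (t1 + (p + q)%:Z) a (a + (m1 + (q - m2))%:Z) `&`
        [set l | l (t1 + p%:Z) = a + m1%:Z]) g l =
    \sum_(x in subset_pairs p q m1 m2) g (split_path t1 a x).
  rewrite (reindex_fsbig _ _ _ g (split_path_bij p t1 a m1 m2q)).
  have -> : [set` subset_pairs p q m1 m2] = [set` enum (subset_pairs p q m1 m2)].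
    by apply/seteqP; split=> x /=; rewrite mem_enum.
  by rewrite -fsbig_seq ?enum_uniq // big_enum.
rewrite !reindex; congr (_ / _).
by rewrite sumr_const.
Qed.

(** Applied to paths attaining [mT] and [MT], these bounds keep the set sizes attached to [k1] and
    [k2] within range. *)
Lemma Omega_mid_bounds (t1 a b : int) (p q : nat) (l : int -> int) :
  Omega t1 (t1 + (p + q)%:Z) a b l ->
  a <= l (t1 + p%:Z) <= a + p%:Z /\ l (t1 + p%:Z) <= b <= l (t1 + p%:Z) + q%:Z.
Proof.
move=> lO; have lE := Omega_steps lO (fun n _ => erefl).
set s := (X in path_of_steps _ _ _ X) in lE.
have sum_le (m n : nat) : (\sum_(m <= j < m + n) s j <= n)%N.
  rewrite -[leqRHS](addKn m) -[leqRHS]muln1 -sum_nat_const_nat.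
  by apply: leq_sum => j _; exact: leq_b1.
have := path_of_steps_Omega t1 a (p + q) s; rewrite -lE => -[_ _].
case: lO => _ _ ->; rewrite lE path_of_stepsE ?leq_addr // => ->.
rewrite (@big_cat_nat _ _ _ p 0 (p + q)) ?leq_addr //=.
by have := sum_le 0%N p; have := sum_le p q; rewrite add0n; lia.
Qed.

Theorem lemma4p1 (R : realType) (t : R) (t_in : 0 < t < 1) :
  0 < cprod t < 1 /\
  forall (a b z1 z2 t1 t2 : int),
    t1 + 1 < t2 ->
    0 <= z2 - z1 <= t2 - t1 ->
    0 <= b - a <= t2 - t1 ->
    z1 <= a -> z2 <= b ->
  forall (lbot : int -> int) (S : {fset int}) (T : int),
    Omega t1 t2 z1 z2 lbot ->
    (forall i, i \in S -> t1 + 1 <= i <= t2) ->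
    t1 + 1 <= T <= t2 - 1 ->
  forall mT MT k1 k2 : int,
    is_min [set l T | l in Omega t1 t2 a b] mT ->
    is_max [set l T | l in Omega t1 t2 a b] MT ->
    mT <= k1 -> k1 <= k2 -> k2 <= MT ->
    cprod t * E_free_cond t1 t2 a b (fun l => W t l lbot S) [set l | l T = k1]
    <= E_free_cond t1 t2 a b (fun l => W t l lbot S) [set l | l T = k2].
Proof.
split; first by rewrite cprod_gt0 // cprod_lt1.
move=> a b z1 z2 t1 t2 _ _ _ _ _ lbot S T lbotO St tT mT MT k1 k2.
pose p := absz ((T - t1) : int); pose q := absz ((t2 - T) : int).
have TE : T = t1 + p%:Z by rewrite /p; lia.
have t2E : t2 = t1 + (p + q)%:Z by rewrite /p /q; lia.
rewrite {}t2E {}TE in lbotO St tT *.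
move=> [[l lO lT] _] [[l' lO' lT'] _] mk1 k12 k2M.
have [lb1 lb2] := Omega_mid_bounds lO; have [lb1' lb2'] := Omega_mid_bounds lO'.
rewrite lT in lb1 lb2; rewrite lT' in lb1' lb2'.
(* Reaching height [k] takes [k - a] up-steps before [T]; of the [q] later steps [b - k] go up and
   the rest are flat. Both set sizes grow with [k]. *)
pose m1 := absz ((k1 - a) : int); pose m2 := absz ((q%:Z - (b - k1)) : int).
pose n1 := absz ((k2 - a) : int); pose n2 := absz ((q%:Z - (b - k2)) : int).
have [mn1 mn2] : (m1 <= n1)%N /\ (m2 <= n2)%N by rewrite /m1 /m2 /n1 /n2; lia.
have [n1p n2q] : (n1 <= p)%N /\ (n2 <= q)%N by rewrite /n1 /n2; lia.
have m2q := leq_trans mn2 n2q.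
have k1E : k1 = a + m1%:Z by rewrite /m1; lia.
have k2E : k2 = a + n1%:Z by rewrite /n1; lia.
have bm : b = a + (m1 + (q - m2))%:Z by rewrite /m1 /m2; lia.
have bn : b = a + (n1 + (q - n2))%:Z by rewrite /n1 /n2; lia.
(* The common endpoint [b] is expressed by [m1], [m2] on the left and by [n1], [n2] on the right. *)
rewrite {1}bm {}bn k1E k2E !E_free_cond_split_path // mulrA mulr_sumr.
apply: (@ler_regular_average _ _ _ _ _
  (fun x y : {set 'I_p} * {set 'I_q} => (x.1 \subset y.1) && (x.2 \subset y.2))
  ('C(p - m1, p - n1) * 'C(q - m2, q - n2)) ('C(n1, m1) * 'C(n2, m2))).
(* The degrees are positive because [m1 <= n1 <= p] and [m2 <= n2 <= q]. *)
- by rewrite muln_gt0 !bin_gt0 !leq_sub2l.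
- by rewrite muln_gt0 !bin_gt0 mn1.
- by move=> x xP; rewrite (card_subset_pairs_ge n1p n2q xP).
- by move=> y yQ; rewrite (card_subset_pairs_le _ _ yQ).
move=> x y; rewrite !in_subset_pairs.
move=> /andP[/eqP x1 /eqP x2] /andP[/eqP y1 /eqP y2].
move=> /andP[xy1 xy2]; have [up down] := split_path_gap t1 a xy1 xy2.
have stepP (z : {set 'I_p} * {set 'I_q}) i :
    t1 <= i < t1 + (p + q)%:Z -> is_step (split_path t1 a z) i.
  move=> it; exists (split_steps z (absz ((i - t1) : int))).
  exact: path_of_steps_step.
have startP (z : {set 'I_p} * {set 'I_q}) : split_path t1 a z t1 = a.
  by case: (path_of_steps_Omega t1 a (p + q) (split_steps z)).
apply: (@W_le_unimodal _ _ _ _ _ _ t1 p q) => //.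
- exact: stepP.
- exact: stepP.
- move=> i it; case: lbotO => [[/(_ i it) lb _] _ _].
  by case: lb => /eqP; rewrite subr_eq => /eqP lb;
    [exists false|exists true]; rewrite lb /= addrC.
- by rewrite !startP.
- rewrite /split_path !path_of_stepsE // !sum_split_steps x1 x2 y1 y2.
  by rewrite -bm; rewrite /n1 /n2; lia.
Qed.
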